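(* Let $B(x,y)=\int_0^1t^{x-1}(1-t)^{y-1}\,dt$ for $x,y>0$ be the Beta function, let $0<p,q<\infty$ and let $N$ be a positive integer. Then $$\inf_{\#\mathcal P=N}\|D_{\mathcal P}\|_{p,q}^q=\frac{p}{2^q}\,B(q,1+q/p)$$ and $$\inf_{\#\mathcal P=N}\|\widetilde D_{\mathcal P}\|_{p,q}^q=p\,B(q,1+2q/p),$$ where the infima are extended over all $N$-element point sets $\mathcal P\subset[0,1]$.
   Context: For an $N$-element point set $\mathcal P=\{x_0,\ldots,x_{N-1}\}\subset[0,1]$, the one-parameter discrepancy function is $D_{\mathcal P}(t)=\sum_{n=0}^{N-1}\mathbf 1_{[0,t)}(x_n)-Nt$ for $t\in[0,1]$ ($\mathbf 1_A$ is the indicator function of $A$). The two-parameter discrepancy function is considered on all of $[0,1]^2$ and given by $\widetilde D_{\mathcal P}(t_1,t_2)=D_{\mathcal P}(t_2)-D_{\mathcal P}(t_1)$, which for $t_1\leq t_2$ equals $\sum_{n=0}^{N-1}\mathbf 1_{[t_1,t_2)}(x_n)-N(t_2-t_1)$. For a Lebesgue measurable function $f:A\to\mathbb R$ with $A\subseteq\mathbb R^d$ of Lebesgue measure $1$ (here $A=[0,1]$ for $D_{\mathcal P}$ and $A=[0,1]^2$ for $\widetilde D_{\mathcal P}$), let $\mathbb P(|f|\geq\alpha)$ be the Lebesgue measure of $\{t\in A:|f(t)|\geq\alpha\}$. For $0<p,q<\infty$ the Lorentz norm is $$\|f\|_{p,q}:=p^{1/q}\left(\int_0^\infty\alpha^{q-1}\,\mathbb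 P(|f|\geq\alpha)^{q/p}\,d\alpha\right)^{1/q}.$$ *)

(* Defs.v *)
From HB Require Import structures.
From mathcomp Require Import all_boot all_order all_algebra.
From mathcomp Require Import finmap.
From mathcomp Require Import all_classical all_reals all_analysis.

Set Implicit Arguments.
Unset Strict Implicit.
Unset Printing Implicit Defensive.

Import Order.TTheory GRing.Theory Num.Theory.
Import numFieldNormedType.Exports.

Local Open Scope classical_set_scope.
Local Open Scope ring_scope.

Definition disc {R : realType} (P : {fset R}) (t : R) : R :=
  \sum_(x <- P) \1_(`[0, t[ : set R) x - #|` P|%:R * t.

Definition disc2 {R : realType} (P : {fset R}) (t : R * R) : R :=
  disc P t.2 - disc P t.1.

Definition unit_points {R : realType} (N : nat) : set {fset R} :=
  [set P | #|` P| = N /\ [set` P] `<=` `[0, 1]].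

(* The function lives on A; the values of f outside A are irrelevant. The norm
   is extended-real valued, so no finiteness is presupposed. *)
Definition lorentz_norm {d : measure_display} {T : measurableType d}
    {R : realType} (mu : {measure set T -> \bar R}) (A : set T) (p q : R)
    (f : T -> R) : \bar R :=
  ((p `^ q^-1)%:E *
   (\int[lebesgue_measure]_(a in [set` `]0%R, +oo[%R])
      ((a `^ (q - 1))%:E *
       mu [set t | A t /\ (a <= `|f t|)%R] `^ (q / p))) `^ q^-1)%E.

(* The library's beta_fun only takes natural number arguments. *)
Definition Beta {R : realType} (x y : R) : R :=
  \int[lebesgue_measure]_(t in (`]0, 1[ : set R))
    (t `^ (x - 1) * (1 - t) `^ (y - 1)).

Definition disc_norm {R : realType} (p q : R) (P : {fset R}) : \bar R :=
  lorentz_norm (@lebesgue_measure R) `[0, 1] p q (disc P).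

Definition disc2_norm {R : realType} (p q : R) (P : {fset R}) : \bar R :=
  lorentz_norm (@lebesgue_measure R \x @lebesgue_measure R)%E
    (`[0, 1] `*` `[0, 1]) p q (disc2 P).

(* Main.v *)
Require Import Defs.
From mathcomp Require Import all_boot all_order all_algebra.
From mathcomp Require Import finmap zify ring lra.
From mathcomp Require Import all_classical all_reals all_analysis.
From mathcomp Require Import measurable_realfun.

(** Both infima are attained by the midpoints (2n+1)/(2N), because these
    minimise the distribution function of the discrepancy at every level
    simultaneously; the Lorentz norms then follow by monotonicity.

    The one fact about point sets that matters is that D_P is an integer
    minus N t. Hence D_P(t) is determined modulo 1 by t, and as t runs
    through [0,1] the value -N t runs N times uniformly through the residues
    modulo 1. So the law of D_P under Lebesgue measure has density at most 1:
    D_P takes its values in [a, b] on a set of measure at most b - a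
    ([disc_density_le1]). For the midpoints, D_P moreover stays in
    [-1/2, 1/2], so it is uniformly distributed there ([disc_midpoints]).

    One parameter. The density bound on [-a, a] gives
    P(|D_P| >= a) >= 1 - 2a, with equality for the midpoints.

    Two parameters. Let X and Y be independent copies of a variable with
    density at most 1, and let S(v) = P(X >= v). Then S is 1-Lipschitz,
    whence P(Y >= X + a | X) = S(X + a) >= max(0, S(X) - a). Since S is
    continuous, S(X) is uniform on [0,1], and so
      P(Y >= X + a) >= E max(0, S(X) - a) = (1 - a)^2 / 2
    ([measure_excess_ge]). The expectation is computed by Fubini
    ([integral_excess]). When X lies in [-1/2, 1/2] one has S(v) <= 1/2 - v,
    and the same computation bounds P(Y >= X + a) from above
    ([measure_excess_le]). By symmetry P(|Y - X| >= a) is twice this, that is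
    at least (1 - a)^2, with equality for the midpoints.

    It remains to integrate: a distribution function max(0, 1 - c a)^k has
    as q-th power of its Lorentz norm p c^(-q) B(q, 1 + k q / p)
    ([lorentz_norm_tent]). *)

Set Implicit Arguments.
Unset Strict Implicit.
Unset Printing Implicit Defensive.
Import Order.TTheory GRing.Theory Num.Theory.
Import numFieldNormedType.Exports.
Local Open Scope classical_set_scope.
Local Open Scope ring_scope.

(** * Tent integrals and the Beta function *)

Section beta_integrals.
Context {R : realType}.
Notation mu := (@lebesgue_measure R).

Lemma measurable_fun_powR d (T : measurableType d) (A : set T) (g : T -> R) s :
  measurable_fun A g -> measurable_fun A (fun x => g x `^ s).
Proof. by move=> mg; apply: (measurableT_comp (measurable_powR s) mg). Qed.

(** The scaled image of Lebesgue measure agrees with Lebesgue measure on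
    half-open intervals, hence everywhere. Going through measures rather than
    through a primitive avoids any continuity requirement on f, which may be
    singular at 0 and truncated. *)
Lemma ge0_integral_homothety (c : R) (f : R -> \bar R) : 0 < c ->
  measurable_fun setT f -> (forall x, (0 <= f x)%E) ->
  (\int[mu]_x f x = c%:E * \int[mu]_x f (c * x)%R)%E.
Proof.
move=> c0 mf f0; pose c' := PosNum c0.
pose phi : measurableTypeR R -> measurableTypeR R := *%R c.
have mphi : measurable_fun setT phi by exact: mulrl_measurable.
pose nu :=
  measure_function_pushforward__canonical__measure_function_Measure mu mphi.
have muE A : measurable A -> mu A = mscale (c'%:num)%:nng nu A.
  apply: lebesgue_measure_unique => //= _ [[a b]] _ <-.
  rewrite /mscale/= /pushforward.
  have -> : phi @^-1` `]a, b] = `]a / c, b / c]%classic.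
    apply/seteqP; split => x /=; rewrite !in_itv/= ler_pdivlMr// ltr_pdivrMr//;
      by rewrite mulrC.
  rewrite /= !lebesgue_measure_itv/= !lte_fin ltr_pM2r ?invr_gt0//.
  case: ifPn => _; last by rewrite mule0.
  by rewrite -!EFinB -EFinM -mulrBl mulrCA divff ?mulr1 ?gt_eqF.
rewrite (@eq_measure_integral _ _ _ _ (mscale (c'%:num)%:nng nu)); last first.
  by move=> A mA _; exact: muE.
by rewrite ge0_integral_mscale//= ge0_integral_pushforward.
Qed.

(** For q < 1 the integrand is unbounded at 0, so the fundamental theorem is
    used on [1/n, 1], where it bounds the integral by 1/q, and monotone
    convergence gives the rest. *)
Lemma integral_powR_lty (q : R) : 0 < q ->
  (\int[mu]_(t in `]0%R, 1%R[) (t `^ (q - 1))%:E < +oo)%E.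
Proof.
move=> q0; pose F n : set R := `[n.+1%:R^-1, 1]%classic.
have -> : (\int[mu]_(t in `]0%R, 1%R[) (t `^ (q - 1))%:E =
    \int[mu]_(t in \bigcup_n F n) (t `^ (q - 1))%:E)%E.
  rewrite integral_itv_bndo_bndc; last first.
    apply/measurable_EFinP; apply: measurable_funTS; exact: measurable_powR.
  congr (integral _ _ _); apply/seteqP; split => x /=.
    rewrite in_itv/= => /andP[x0 x1].
    have [n _ nx] : exists2 n, True & n.+1%:R^-1 <= x.
      exists (Num.truncn x^-1) => //.
      rewrite invf_ple ?posrE//. apply/ltW. exact: truncnS_gt.
    by exists n => //; rewrite /F /= in_itv/= nx.
  move=> [n _]; rewrite /F/= !in_itv/= => /andP[nx ->]; rewrite andbT.
  by apply: lt_le_trans nx; rewrite invr_gt0.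
have mp (A : set R) : measurable_fun A (fun t : R => (t `^ (q - 1))%:E).
  by apply/measurable_EFinP; apply: measurable_funTS; exact: measurable_powR.
have nd : nondecreasing_seq F.
  apply/nondecreasing_seqP => n; apply/subsetPset => x; rewrite /F/= !in_itv/=.
  case/andP => h ->; rewrite andbT; apply: le_trans h.
  by rewrite lef_pV2 ?posrE// ler_nat.
have := @ge0_nondecreasing_set_cvg_integral _ (measurableTypeR R) _ F
  (fun t : R => (t `^ (q - 1))%:E) mu nd _ _ _.
move=> /(_ (fun i => measurable_itv _) (fun i => mp _)).
have pge : forall i x, F i x -> (0 <= (x `^ (q - 1))%:E)%E.
  by move=> i x _; rewrite lee_fin powR_ge0.
move=> /(_ pge) cvF.
apply: (@le_lt_trans _ _ (q^-1)%:E); last exact: ltry.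
rewrite -(cvg_lim _ cvF)//; apply: lime_le; first by apply/cvg_ex; eexists; exact: cvF.
apply: nearW => n.
case: n => [|n].
  by rewrite /F invr1 set_itv1 integral_set1 lee_fin invr_ge0 ltW.
have a0 : 0 < n.+2%:R^-1 :> R by rewrite invr_gt0.
have a1 : n.+2%:R^-1 < 1 :> R by rewrite invf_lt1// ltr1n.
have cont b (x : R) : 0 < x -> {for x, continuous (fun t : R => t `^ b)}.
  move=> x0; apply: differentiable_continuous; apply/derivable1_diffP.
  by apply: derivable_powR; rewrite in_itv/= x0.
rewrite /F (@continuous_FTC2 _ _ (fun t => q^-1 * t `^ q))//.
- rewrite powR1 mulr1 -EFinB lee_fin gerBl.
  by rewrite mulr_ge0 ?powR_ge0// invr_ge0 ltW.
- apply: continuous_in_subspaceT => x; rewrite inE/= in_itv/= => /andP[h _].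
  by apply: cont; exact: lt_le_trans h.
- split.
  + move=> x; rewrite in_itv/= => /andP[h _]; apply: derivableM => //.
    by apply: derivable_powR; rewrite in_itv/= andbT (lt_trans _ h).
  + by apply: cvg_at_right_filter; apply: cvgM; [exact: cvg_cst|exact: cont].
  + by apply: cvg_at_left_filter; apply: cvgM; [exact: cvg_cst|exact: cont].
- move=> x; rewrite in_itv/= => /andP[h _].
  have x0 : 0 < x by rewrite (lt_trans _ h).
  have dx : derivable (fun t : R => t `^ q) x 1.
    by apply: derivable_powR; rewrite in_itv/= x0.
  rewrite derive1Ml// powR_derive1 ?in_itv/= ?x0//.
  by rewrite mulrA mulVf ?mul1r// gt_eqF.
Qed.

(** [Beta] is a real-valued integral, which is 0 by convention when the
    underlying integral diverges; finiteness is what identifies the two. *)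
Lemma Beta_integral (q r : R) : 0 < q -> 0 <= r ->
  (Beta q (1 + r))%:E =
  (\int[mu]_(t in `]0%R, 1%R[) (t `^ (q - 1) * (1 - t) `^ r)%:E)%E.
Proof.
move=> q0 r0; rewrite /Beta /Rintegral fineK.
  by rewrite (_ : 1 + r - 1 = r)//; ring.
rewrite (_ : 1 + r - 1 = r); last by ring.
rewrite ge0_fin_numE; last first.
  by apply: integral_ge0 => x _; rewrite lee_fin mulr_ge0 ?powR_ge0.
apply: le_lt_trans (integral_powR_lty q0).
apply: ge0_le_integral => //.
- by move=> x _; rewrite lee_fin mulr_ge0 ?powR_ge0.
- apply/measurable_EFinP; apply: measurable_funM; apply: measurable_fun_powR => //.
  by apply: measurable_funB.
- apply/measurable_EFinP; exact: measurable_fun_powR.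
- move=> x /=; rewrite in_itv/= => /andP[x0 x1]; rewrite lee_fin ler_piMr ?powR_ge0//.
  rewrite [leRHS](_ : 1 = 1 `^ r); last by rewrite powR1.
  apply: ge0_ler_powR => //; rewrite ?nnegrE ?subr_ge0 ?ltW//.
  by rewrite gtrBl.
Qed.

(** The substitution a = t / c turns the tent into 1 - t; it vanishes beyond
    t = 1, which cuts the domain down to the unit interval. *)
Lemma integral_powR_tent (c q r : R) : 0 < c -> 0 < q -> 0 < r ->
  (\int[mu]_(a in `]0%R, +oo[)
     (a `^ (q - 1) * (Num.max 0 (1 - c * a)) `^ r)%:E =
   ((c `^ q)^-1 * Beta q (1 + r))%:E)%E.
Proof.
move=> c0 q0 r0.
have key : (\int[mu]_(a in `]0%R, +oo[)
     (a `^ (q - 1) * (Num.max 0 (1 - c * a)) `^ r)%:E =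
   (c^-1)%:E * \int[mu]_(t in `]0%R, 1%R[)
      ((c^-1 * t) `^ (q - 1) * (1 - t) `^ r)%:E)%E.
  have mf (A : set R) : measurable_fun A
      (fun a => (a `^ (q - 1) * (Num.max 0 (1 - c * a)) `^ r)%:E).
    apply/measurable_EFinP; apply: measurable_funTS; apply: measurable_funM => //.
    apply: measurable_fun_powR; apply: measurable_maxr => //.
    by apply: measurable_funB => //; exact: mulrl_measurable.
  rewrite integral_mkcond (@ge0_integral_homothety c^-1) ?invr_gt0//; last 2 first.
  - by apply/(measurable_restrictT _ _).1.
  - by apply: erestrict_ge0 => x _; rewrite lee_fin mulr_ge0 ?powR_ge0.
  congr (_ * _)%E; rewrite [RHS]integral_mkcond; apply: eq_integral => x _.
  rewrite !patchE mulrA divff ?gt_eqF// mul1r.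
  case: ifPn => [|/negP]; rewrite inE/= in_itv/= andbT pmulr_rgt0 ?invr_gt0// => x0;
    case: ifPn => [|/negP]; rewrite inE/= in_itv/=.
  + by move=> /andP[_ x1]; rewrite max_r// subr_ge0 ltW.
  + rewrite x0/= => /negP; rewrite -leNgt => x1.
    by rewrite max_l ?subr_le0// powR0 ?mulr0// gt_eqF.
  + by move=> /andP[].
  + by [].
have scale : (\int[mu]_(t in `]0%R, 1%R[)
      ((c^-1 * t) `^ (q - 1) * (1 - t) `^ r)%:E =
    (c^-1 `^ (q - 1))%:E * (Beta q (1 + r))%:E)%E.
  rewrite (Beta_integral q0 (ltW r0)) -ge0_integralZl_EFin ?powR_ge0//; first last.
  - apply/measurable_EFinP; apply: measurable_funM; apply: measurable_fun_powR => //.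
    by apply: measurable_funB.
  - by move=> x _; rewrite lee_fin mulr_ge0 ?powR_ge0.
  apply: eq_integral => x; rewrite inE/= in_itv/= => /andP[x0 x1].
  by rewrite -EFinM powRM ?mulrA// ?invr_ge0 ltW.
rewrite key {}scale -!EFinM; congr EFin.
rewrite mulrA mulr_powRB1 ?invr_ge0 ?ltW//; congr (_ * _).
by rewrite -powR_inv1 ?ltW// -powRrM mulN1r powRN.
Qed.

End beta_integrals.

(** * Lorentz norms of functions with a tent distribution *)

Section lorentz.
Context d (T : measurableType d) (R : realType).
Variables (m : {measure set T -> \bar R}) (A : set T) (p q : R).
Hypotheses (p0 : 0 < p) (q0 : 0 < q).
Notation mu := (@lebesgue_measure R).
Implicit Types f : T -> R.

Lemma lorentz_norm_powR f :
  (lorentz_norm m A p q f `^ q)%E =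
  (p%:E * \int[mu]_(a in `]0%R, +oo[)
     ((a `^ (q - 1))%:E * m [set t | A t /\ (a <= `|f t|)%R] `^ (q / p)))%E.
Proof.
rewrite /lorentz_norm.
have I0 : (0 <= \int[mu]_(a in `]0%R, +oo[)
    ((a `^ (q - 1))%:E * m [set t | A t /\ (a <= `|f t|)%R] `^ (q / p)))%E.
  by apply: integral_ge0 => x _; rewrite mule_ge0 ?poweR_ge0// lee_fin powR_ge0.
rewrite poweRM ?lee_fin ?powR_ge0 ?poweR_ge0//.
rewrite poweR_EFin -powRrM mulVf ?gt_eqF// powRr1 ?ltW//.
by rewrite -poweRrM mulVf ?gt_eqF// poweRe1.
Qed.

Let tent_integral (c : R) (k : nat) : 0 < c -> (0 < k)%N ->
  (\int[mu]_(a in `]0%R, +oo[) ((a `^ (q - 1))%:E *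
     (Num.max 0 (1 - c * a) ^+ k)%:E `^ (q / p)) =
   ((c `^ q)^-1 * Beta q (1 + k%:R * q / p))%:E)%E.
Proof.
move=> c0 k0; have kqp : 0 < k%:R * q / p.
  by rewrite !mulr_gt0 ?invr_gt0 ?ltr0n.
rewrite -(integral_powR_tent c0 q0 kqp).
apply: eq_integral => a _; rewrite poweR_EFin -EFinM.
rewrite -powR_mulrn ?le_max ?lexx// -powRrM.
by rewrite mulrA.
Qed.

Lemma lorentz_norm_tent f (c : R) (k : nat) : 0 < c -> (0 < k)%N ->
  (forall a : R, 0 < a -> m [set t | A t /\ (a <= `|f t|)%R] =
     (Num.max 0 (1 - c * a) ^+ k)%:E) ->
  (lorentz_norm m A p q f `^ q)%E =
  (p * ((c `^ q)^-1 * Beta q (1 + k%:R * q / p)))%:E.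
Proof.
move=> c0 k0 fE; rewrite lorentz_norm_powR (EFinM p) -tent_integral//.
congr (_ * _)%E; apply: eq_integral => a.
by rewrite inE/= in_itv/= andbT => a0; rewrite fE.
Qed.

(** The right-hand integrand is measurable because a distribution function is
    monotone. *)
Lemma lorentz_norm_ge_tent f (c : R) (k : nat) : 0 < c -> (0 < k)%N ->
  measurable A -> (m A < +oo)%E -> measurable_fun A f ->
  (forall a : R, 0 < a -> ((Num.max 0 (1 - c * a) ^+ k)%:E <=
     m [set t | A t /\ (a <= `|f t|)%R])%E) ->
  ((p * ((c `^ q)^-1 * Beta q (1 + k%:R * q / p)))%:E <=
   lorentz_norm m A p q f `^ q)%E.
Proof.
move=> c0 k0 mA Aoo mf fE; rewrite lorentz_norm_powR (EFinM p) -tent_integral//.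
have mS (a : R) : measurable [set t | A t /\ (a <= `|f t|)%R].
  rewrite (_ : mkset _ = A `&` [set t | a <= (Num.norm \o f) t]) //.
  have mnf : measurable_fun A (Num.norm \o f) by exact: measurableT_comp.
  have := mnf mA `[a, +oo[%classic (measurable_itv _).
  congr (measurable (_ `&` _)); apply/seteqP.
  by split => x /=; rewrite in_itv/= andbT.
have mfin (a : R) : m [set t | A t /\ (a <= `|f t|)%R] \is a fin_num.
  rewrite ge0_fin_numE ?measure_ge0//; apply: le_lt_trans Aoo.
  by apply: le_measure; rewrite ?inE// => x [].
rewrite lee_pmul2l ?lte_fin//.
apply: ge0_le_integral => //.
- by move=> a _; rewrite mule_ge0 ?poweR_ge0// lee_fin powR_ge0.
- rewrite (_ : (fun a => _) = (fun a => (a `^ (q - 1) *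
      (Num.max 0 (1 - c * a) ^+ k) `^ (q / p))%:E)); last first.
    by apply/funext => a; rewrite EFinM -[in RHS](poweR_EFin (_ ^+ _)).
  apply/measurable_EFinP; apply: measurable_funM; apply: measurable_fun_powR => //.
  apply: measurable_funX; apply: measurable_maxr => //.
  by apply: measurable_funB => //; exact: mulrl_measurable.
- rewrite (_ : (fun a => _) = (fun a => (a `^ (q - 1) *
      fine (m [set t | A t /\ a <= `|f t|]) `^ (q / p))%:E)); last first.
    by apply/funext => a; rewrite EFinM -(poweR_EFin (fine _)) fineK.
  apply/measurable_EFinP; apply: measurable_funM; apply: measurable_fun_powR => //.
  apply: nonincreasing_measurable => // a b ab.
  rewrite fine_le//; apply: le_measure; rewrite ?inE// => x [Ax bx]; split => //.
  exact: le_trans bx.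
- move=> a /=; rewrite in_itv/= andbT => a0.
  rewrite lee_wpmul2l ?lee_fin ?powR_ge0//.
  rewrite -(fineK (mfin a)) poweR_EFin lee_fin.
  apply: ge0_ler_powR; rewrite ?nnegrE ?fine_ge0// ?divr_ge0 ?(ltW p0) ?(ltW q0)//.
    by rewrite exprn_ge0// le_max lexx.
  by rewrite -lee_fin fineK// fE.
Qed.

End lorentz.

(** * The discrepancy function has density at most one *)

Section discrepancy.
Context {R : realType}.
Notation mu := (@lebesgue_measure R).
Implicit Types (P : {fset R}) (t : R).

Lemma disc_nat P t : exists k : nat, disc P t = k%:R - #|` P|%:R * t.
Proof.
suff [k kE] : exists k : nat, \sum_(x <- P) \1_(`[0, t[ : set R) x = k%:R :> R.
  by exists k; rewrite /disc kE.
elim/big_ind : _ => [|x y [k ->] [l ->]|x _]; first by exists 0%N.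
- by exists (k + l)%N; rewrite natrD.
- by eexists; rewrite indicE.
Qed.

Lemma measurable_disc P : measurable_fun setT (disc P).
Proof.
apply: measurable_funB; last exact: mulrl_measurable.
apply: nondecreasing_measurable => // s t st; apply: ler_sum => x _.
rewrite !indicE ler_nat; have [|//] := boolP (x \in _).
rewrite inE/= in_itv/= => /andP[x0 xs].
by rewrite mem_set//= in_itv/= x0 (lt_le_trans xs).
Qed.

(** Cut [0,1) into N cells of length 1/N and write t = (j + s) / N in the j-th
    one. Then D_P(t) is an integer minus s, so D_P(t) in [a, b] confines s to
    an arc of length b - a of the circle R/Z, which unrolls to at most two
    intervals in [0,1). Each cell therefore contributes at most (b - a) / N. *)
Lemma disc_density_le1 P (a b : R) : (0 < #|` P|)%N -> a <= b ->
  (mu [set t | `[0%R, 1%R]%classic t /\ (a <= disc P t <= b)%R] <= (b - a)%:E)%E.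
Proof.
move=> N0 ab; set N := #|` P| in N0; set S := mkset _.
have n0 : 0 < N%:R :> R by rewrite ltr0n.
have mS : measurable S.
  have := @measurable_disc P measurableT _ (measurable_itv `[a, b]).
  move=> /(measurableI _ _ (measurable_itv `[0%R, 1%R]))/=.
  by rewrite setTI; congr (measurable (_ `&` _)).
have [ab1|ab1] := leP 1 (b - a).
  apply: (@le_trans _ _ (mu `[0%R, 1%R]%classic)).
    by apply: le_measure; rewrite ?inE// => x [].
  by rewrite lebesgue_measure_itv/= lte_fin ltr01 -EFinB subr0 lee_fin.
(* The arc starts at c, the fractional part of -b, and has length l. *)
pose l := b - a; pose c : R := - b - (Num.floor (- b))%:~R.
have c0 : 0 <= c by rewrite subr_ge0 ge_floor.
have c1 : c < 1 by rewrite ltrBlDl; have := floorD1_gt (- b); rewrite intrD.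
(* The second interval is the part of the arc that wraps around past 1. *)
pose A j : set R :=
  `[(j%:R + c) / N%:R, (j%:R + Num.min 1 (c + l)) / N%:R]%classic `|`
  `[j%:R / N%:R, (j%:R + (c + l - 1)) / N%:R]%classic.
have mA j : measurable (A j) by apply: measurableU.
have Asub : S `\ 1 `<=` \big[setU/set0]_(j < N) A j.
  move=> t [[]]; rewrite /= in_itv/= => /andP[t0 t1].
  have [k kE] := disc_nat P t; rewrite kE -/N => /andP[ak kb] tn1.
  have {tn1}t1 : t < 1 by rewrite lt_neqAle t1 andbT; apply/eqP.
  have Nt0 : 0 <= N%:R * t by rewrite mulr_ge0// ltW.
  pose j := Num.truncn (N%:R * t).
  have /andP[jN Nj] : j%:R <= N%:R * t < j.+1%:R by exact: truncn_itv.
  have jltN : (j < N)%N.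
    by rewrite -(ltr_nat R) (le_lt_trans jN)// gtr_pMr.
  rewrite -bigcup_mkord; exists j => //.
  pose s := N%:R * t - j%:R.
  have s0 : 0 <= s by rewrite subr_ge0.
  have s1 : s < 1 by rewrite /s ltrBlDl natr1.
  (* m says on which turn of the circle s meets the arc. *)
  pose m : int := Num.floor (- b) + k%:Z - j%:Z.
  have mE : m%:~R = (Num.floor (- b))%:~R + k%:R - j%:R :> R.
    by rewrite /m intrB intrD.
  have sm : c + m%:~R <= s by rewrite mE /c /s; lra.
  have ms : s <= c + l + m%:~R by rewrite mE /c /s /l; lra.
  have mle0 : m <= 0.
    by rewrite -ltzD1 add0r -(ltr_int R); lra.
  have mgeN1 : -1 <= m.
    rewrite lerNl -ltzD1 -(ltr_int R) intrN; rewrite /l in ms; lra.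
  have tE : t = (j%:R + s) / N%:R.
    by rewrite /s addrC subrK mulrAC divff ?mul1r// gt_eqF.
  have [m0|m1] : m = 0 \/ m = -1.
    by move: (m) mle0 mgeN1 => i i0 i1; clear -i0 i1; lia.
  - left; rewrite /= in_itv/= tE !ler_pM2r ?invr_gt0// !lerD2l.
    move: sm ms; rewrite m0 !addr0 => -> h /=.
    by rewrite le_min h ltW.
  - right; rewrite /= in_itv/= tE !ler_pM2r ?invr_gt0// !lerD2l.
    by rewrite lerDl s0/=; move: ms; rewrite m1.
have S1 : S `<=` (S `\ 1) `|` [set 1].
  by move=> t St; have [->|t1] := eqVneq t 1; [right|left; split=> //; apply/eqP].
have mS1 : measurable (S `\ 1) by exact: measurableD.
apply: (@le_trans _ _ (mu (S `\ 1) + mu [set 1])).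
  by apply: le_trans (measureU2 _ _ _) => //; apply: le_measure;
    rewrite ?inE//; exact: measurableU.
rewrite lebesgue_measure_set1 adde0.
have Al j : (mu (A j) <= (l / N%:R)%:E)%E.
  apply: le_trans (measureU2 _ _ _) _ => //.
  rewrite /= !lebesgue_measure_itv/= !lte_fin !ltr_pM2r ?invr_gt0//.
  rewrite -!EFinB -!mulrBl ltrD2l ltrDl.
  have l0 : 0 <= l by rewrite subr_ge0.
  have [cl1|cl1] := leP 1 (c + l).
  - rewrite c1; have [?|?] := ltP 0 (c + l - 1); last first.
      rewrite adde0 lee_fin ler_wpM2r ?invr_ge0 ?ler0n//; lra.
    rewrite -EFinD lee_fin -mulrDl ler_wpM2r ?invr_ge0 ?ler0n//; lra.
  - have -> : (0 < c + l - 1) = false by apply/negbTE; rewrite -leNgt; lra.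
    rewrite adde0; case: ifPn => _; rewrite lee_fin ?divr_ge0 ?ler0n//.
    rewrite ler_wpM2r ?invr_ge0 ?ler0n//; lra.
apply: (@le_trans _ _ (\sum_(j < N) mu (A j))%E).
  by apply: (@content_subadditive _ _ _ mu _ A N _ mS1 Asub) => j _; exact: mA.
apply: (@le_trans _ _ (\sum_(j < N) (l / N%:R)%:E)%E); first exact: lee_sum.
by rewrite sumEFin sumr_const card_ord -mulrnAl -mulr_natl mulrAC divff ?mul1r// gt_eqF.
Qed.

Definition midpoints (N : nat) : {fset R} :=
  [fset (i%:R + 2^-1) / N%:R | i in iota 0 N]%fset.

Lemma midpoint_inj N : (0 < N)%N ->
  injective (fun i : nat => (i%:R + 2^-1) / N%:R : R).
Proof.
move=> N0 i j; have Nn0 : N%:R^-1 != 0 :> R by rewrite invr_eq0 pnatr_eq0 -lt0n.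
by move=> /(mulIf Nn0) /addIr /eqP; rewrite eqr_nat => /eqP.
Qed.

Lemma midpoints_unit N : (0 < N)%N -> unit_points N (midpoints N).
Proof.
move=> N0; have n0 : 0 < N%:R :> R by rewrite ltr0n.
split => [/=|x /=].
  rewrite card_imfset/= ?undup_id ?iota_uniq ?size_iota//.
  exact: midpoint_inj.
move=> /imfsetP[i /=]; rewrite mem_iota add0n => /andP[_ iN] ->.
rewrite in_itv/= divr_ge0 ?addr_ge0 ?invr_ge0 ?ler0n//=.
rewrite ler_pdivrMr// mul1r.
have : i.+1%:R <= N%:R :> R by rewrite ler_nat.
by rewrite -natr1; lra.
Qed.

(** The number of half-integers in (0, y) is y rounded to a nearest integer,
    except that it cannot exceed N; the minimum makes the induction go
    through. *)
Lemma midpoint_count (N : nat) (y : R) : 0 <= y ->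
  Num.min N%:R (y - 2^-1) <= \sum_(i <- iota 0 N) ((i%:R + 2^-1 < y)%R : nat)%:R <= y + 2^-1.
Proof.
move=> y0; elim: N => [|N IH].
  by rewrite big_nil ge_min lexx/=; lra.
rewrite -addn1 iotaD big_cat/= big_seq1 add0n addn1 -natr1.
have upper : \sum_(i <- iota 0 N) ((i%:R + 2^-1 < y)%R : nat)%:R <= N%:R :> R.
  rewrite -[leRHS](_ : \sum_(i <- iota 0 N) 1 = N%:R).
    by apply: ler_sum => i _; rewrite lern1 leq_b1.
  by rewrite big_const_seq/= count_predT size_iota iter_addr_0.
have [lty|gey] := ltP (N%:R + 2^-1) y; last first.
  rewrite addr0; move/andP : IH => [IH1 ->]; rewrite andbT.
  apply: le_trans IH1; rewrite le_min !ge_min; lra.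
move/andP: IH => [IH1 _]; rewrite mulr1n; apply/andP; split; last by lra.
rewrite ge_min; apply/orP; left; rewrite lerD2r; apply: le_trans IH1.
by rewrite le_min lexx/=; lra.
Qed.

Lemma disc_midpoints (N : nat) t : (0 < N)%N -> 0 <= t <= 1 ->
  - 2^-1 <= disc (midpoints N) t <= 2^-1.
Proof.
move=> N0 /andP[t0 t1]; have n0 : 0 < N%:R :> R by rewrite ltr0n.
have [cardN _] := midpoints_unit N0.
have cE : \sum_(x <- midpoints N) \1_(`[0, t[ : set R) x =
    \sum_(i <- iota 0 N) ((i%:R + 2^-1 < N%:R * t)%R : nat)%:R :> R.
  rewrite big_imfset/= ?undup_id ?iota_uniq//; last first.
    by move=> i j _ _; exact: midpoint_inj.
  apply: eq_bigr => i _; rewrite indicE; congr (nat_of_bool _)%:R.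
  rewrite mem_setE in_itv/= ltr_pdivrMr// (mulrC t).
  by rewrite divr_ge0 ?addr_ge0 ?invr_ge0 ?ler0n.
have Nt0 : 0 <= N%:R * t by rewrite mulr_ge0// ltW.
have NtN : N%:R * t <= N%:R by rewrite ger_pMr.
have /andP[] := midpoint_count N Nt0.
rewrite /disc cE cardN ge_min => /orP h1 h2.
by apply/andP; split; [case: h1|]; lra.
Qed.

End discrepancy.

(** * Functions on the unit interval with density at most one *)

Section equidistributed.
Context {R : realType}.
Notation mu := (@lebesgue_measure R).
Notation I := (`[0%R, 1%R]%classic : set R).

Lemma lebesgue_unit_itv : mu I = 1%E.
Proof. by rewrite lebesgue_measure_itv/= lte_fin ltr01 -EFinB subr0. Qed.

Lemma measurable_ler_set d (T : measurableType d) (f g : T -> R) :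
  measurable_fun setT f -> measurable_fun setT g ->
  measurable [set x | f x <= g x].
Proof.
move=> mf mg; have := measurable_funB mg mf.
move=> /(_ measurableT _ (measurable_itv `[0, +oo[)).
rewrite setTI; congr measurable; apply/seteqP.
by split => x /=; rewrite in_itv/= andbT subr_ge0.
Qed.

Lemma fubini_section (A : set (measurableTypeR R * measurableTypeR R)) :
  measurable A ->
  (\int[mu]_x mu (xsection A x) = \int[mu]_y mu (ysection A y))%E.
Proof.
move=> mA; have := @indic_fubini_tonelli _ _ _ _ _ mu mu A mA.
by rewrite indic_fubini_tonelli_FE// indic_fubini_tonelli_GE.
Qed.

Lemma integral_onem (a : R) : a <= 1 ->
  (\int[mu]_(u in `[a, 1%R]) (1 - u)%:E = ((1 - a) ^+ 2 / 2)%:E)%E.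
Proof.
rewrite le_eqVlt => /predU1P[->|a1].
  by rewrite set_itv1 integral_set1 subrr expr0n/= mul0r.
rewrite (@continuous_FTC2 _ _ (fun u => u - u ^+ 2 / 2))//.
- by rewrite -EFinB; congr EFin; field.
- by apply: continuous_subspaceT => x; apply: cvgB; [exact: cvg_cst|exact: cvg_id].
- have cF : continuous (fun u : R => u - u ^+ 2 / 2).
    move=> x; apply: cvgB; first exact: cvg_id.
    by apply: cvgM; [exact: exprn_continuous|exact: cvg_cst].
  split => [x _| |]; last 2 first.
  + by apply: cvg_at_right_filter; exact: cF.
  + by apply: cvg_at_left_filter; exact: cF.
  + by apply: derivableB => //; apply: derivableM => //; exact: exprn_derivable.
- move=> x _; rewrite derive1E deriveB// derive_id.
  rewrite -derive1E derive1Mr//.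
  by rewrite exp_derive1 expr1 /GRing.scale/=; field.
Qed.

(** Both sides are the area of the region a <= u <= g(s) above the unit
    interval, cut in the two directions. *)
Lemma integral_excess (g : R -> R) (a : R) :
  measurable_fun setT g -> (forall s, I s -> g s <= 1) ->
  (\int[mu]_(s in I) (Num.max 0 (g s - a))%:E =
   \int[mu]_(u in `[a, 1%R]) mu [set s | I s /\ (u <= g s)%R])%E.
Proof.
move=> mg g1.
pose B : set (measurableTypeR R * measurableTypeR R) :=
  [set z | [/\ I z.1, `[a, 1%R]%classic z.2 & z.2 <= g z.1]].
have mB : measurable B.
  have -> : B = (I `*` `[a, 1%R]%classic) `&`
      [set z : measurableTypeR R * measurableTypeR R | (z.2 <= g z.1)%R].
    by apply/seteqP; split => z /= => [[]|[[]]].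
  apply: measurableI; first exact: measurableX.
  by apply: measurable_ler_set; [|apply: measurableT_comp].
rewrite integral_mkcond [RHS]integral_mkcond.
transitivity (\int[mu]_s mu (xsection B s))%E.
  apply: eq_integral => s _; rewrite patchE; case: ifPn => [|/negP]; rewrite inE => sI.
    rewrite (_ : xsection B s = `[a, g s]%classic); last first.
      apply/seteqP; split => u; rewrite /xsection/= inE/B/= ?in_itv/=.
        by move=> [_ /andP[-> _] ->].
      by move=> /andP[au ug]; split => //; rewrite au (le_trans ug (g1 _ sI)).
    rewrite lebesgue_measure_itv/= lte_fin.
    case: ltP => ag; first by rewrite max_r// ?subr_ge0 ltW.
    by rewrite max_l// subr_le0.
  rewrite (_ : xsection B s = set0) ?measure0//; apply/seteqP; split => u //.
  by rewrite /xsection/= inE/B/= => -[].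
rewrite fubini_section//.
apply: eq_integral => u _; rewrite patchE; case: ifPn => [|/negP]; rewrite inE => uI.
  congr (mu _); apply/seteqP; split => s; rewrite /ysection/= inE/B/=.
    by case.
  by case.
rewrite (_ : ysection B u = set0) ?measure0//; apply/seteqP; split => s //.
by rewrite /ysection/= inE/B/= => -[].
Qed.

Section distribution.
Variable D : R -> R.
Hypothesis mD : measurable_fun setT D.
Hypothesis D_density : forall a b, a <= b ->
  (mu [set t | I t /\ (a <= D t <= b)%R] <= (b - a)%:E)%E.

Lemma measurable_le_D v : measurable [set t | I t /\ v <= D t].
Proof.
have := @mD measurableT _ (measurable_itv `[v, +oo[).
move=> /(measurableI _ _ (measurable_itv `[0%R, 1%R])).
rewrite setTI; congr (measurable (_ `&` _)); apply/seteqP.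
by split => t /=; rewrite in_itv/= andbT.
Qed.

Lemma measurable_D_le v : measurable [set t | I t /\ D t <= v].
Proof.
have := @mD measurableT _ (measurable_itv `]-oo, v]).
by move=> /(measurableI _ _ (measurable_itv `[0%R, 1%R])); rewrite setTI.
Qed.

Lemma measurable_D_itv a b : measurable [set t | I t /\ a <= D t <= b].
Proof.
have := @mD measurableT _ (measurable_itv `[a, b]).
by move=> /(measurableI _ _ (measurable_itv `[0%R, 1%R])); rewrite setTI.
Qed.

Lemma measurable_le_absD v : measurable [set t | I t /\ v <= `|D t|].
Proof.
have -> : [set t | I t /\ v <= `|D t|] =
    [set t | I t /\ v <= D t] `|` [set t | I t /\ D t <= - v].
  apply/seteqP; split => t /=.
    by move=> [It]; rewrite ler_normr lerNr => /orP[h|h]; [left|right].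
  by move=> [[It h]|[It h]]; split => //; rewrite ler_normr lerNr h ?orbT.
by apply: measurableU; [exact: measurable_le_D|exact: measurable_D_le].
Qed.

(** The complement is contained in the set where D lies in [-a, a], which
    has measure at most 2a. *)
Lemma measure_le_absD_ge a : 0 < a ->
  ((Num.max 0 (1 - 2 * a))%:E <= mu [set t | I t /\ (a <= `|D t|)%R])%E.
Proof.
move=> a0; rewrite EFin_max ge_max measure_ge0/=.
rewrite EFinB leeBlDr// -lebesgue_unit_itv.
apply: (@le_trans _ _ (mu ([set t | I t /\ (a <= `|D t|)%R] `|`
    [set t | I t /\ (- a <= D t <= a)%R]))).
  apply: le_measure; rewrite ?inE//.
    by apply: measurableU; [exact: measurable_le_absD|exact: measurable_D_itv].
  move=> t It; have [?|?] := leP a `|D t|; [by left|right; split => //].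
  by rewrite -ler_norml ltW.
apply: le_trans (measureU2 _ _ _) _.
- exact: measurable_le_absD.
- exact: measurable_D_itv.
rewrite leeD2l//; apply: le_trans (D_density _) _; first lra.
by rewrite lee_fin; lra.
Qed.

Lemma measure_le_absD_eq a : 0 < a -> (forall t, I t -> - 2^-1 <= D t <= 2^-1) ->
  mu [set t | I t /\ (a <= `|D t|)%R] = (Num.max 0 (1 - 2 * a))%:E.
Proof.
move=> a0 Dhalf; apply/eqP; rewrite eq_le measure_le_absD_ge// andbT.
have [a2|a2] := leP a 2^-1; last first.
  rewrite (_ : mkset _ = set0) ?measure0 ?lee_fin ?le_max ?lexx//.
  apply/seteqP; split => t //= -[It]; rewrite leNgt => /negP; apply.
  by apply: le_lt_trans a2; rewrite ler_norml Dhalf.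
apply: (@le_trans _ _ (mu ([set t | I t /\ (a <= D t <= 2^-1)%R] `|`
    [set t | I t /\ (- 2^-1 <= D t <= - a)%R]))).
  apply: le_measure; rewrite ?inE//.
  - exact: measurable_le_absD.
  - by apply: measurableU; exact: measurable_D_itv.
  move=> t [It]; have /andP[h1 h2] := Dhalf t It.
  by rewrite ler_normr lerNr => /orP[h|h]; [left|right]; rewrite /= h ?h1 ?h2.
apply: le_trans (measureU2 _ _ _) _; [exact: measurable_D_itv..|].
apply: le_trans (leeD (D_density _) (D_density _)) _; [lra|lra|].
by rewrite -EFinD lee_fin le_max; apply/orP; right; lra.
Qed.

End distribution.
End equidistributed.

(** * Differences at two independent points *)

Section survival.
Context {R : realType}.
Notation mu := (@lebesgue_measure R).
Notation I := (`[0%R, 1%R]%classic : set R).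
Variable D : R -> R.
Hypothesis mD : measurable_fun setT D.

(** The complementary distribution function of D under Lebesgue measure on
    [0,1]. *)
Definition survival (v : R) : R := fine (mu [set t | I t /\ v <= D t]).

Lemma survivalE v : (survival v)%:E = mu [set t | I t /\ v <= D t].
Proof.
rewrite fineK// ge0_fin_numE//; apply: (@le_lt_trans _ _ (mu I)).
  by apply: le_measure; rewrite ?inE//; [exact: measurable_le_D|move=> x []].
by rewrite lebesgue_unit_itv ltry.
Qed.

Lemma survival_le1 v : survival v <= 1.
Proof.
rewrite -lee_fin survivalE -lebesgue_unit_itv.
by apply: le_measure; rewrite ?inE//; [exact: measurable_le_D|move=> x []].
Qed.

Lemma survival_ge0 v : 0 <= survival v.
Proof. by rewrite -lee_fin survivalE. Qed.

Lemma survival_nonincreasing : {homo survival : v w / v <= w >-> w <= v}.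
Proof.
move=> v w vw; rewrite -lee_fin !survivalE.
apply: le_measure; rewrite ?inE//; [exact: measurable_le_D..|].
by move=> t [It h]; split => //; exact: le_trans h.
Qed.

Lemma measurable_survival : measurable_fun setT survival.
Proof. by apply: nonincreasing_measurable => // v w; exact: survival_nonincreasing. Qed.

Lemma measurable_measure_le (A : set R) :
  measurable_fun A (fun v => mu [set t | I t /\ (v <= D t)%R]).
Proof.
under eq_fun do rewrite -survivalE.
by apply/measurable_EFinP; apply: measurable_funTS; exact: measurable_survival.
Qed.

End survival.

Section two_points.
Context {R : realType}.
Notation mu := (@lebesgue_measure R).
Notation I := (`[0%R, 1%R]%classic : set R).
Variable D : R -> R.
Hypothesis mD : measurable_fun setT D.
Hypothesis D_density : forall a b, a <= b ->
  (mu [set t | I t /\ (a <= D t <= b)%R] <= (b - a)%:E)%E.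
Local Notation S := (survival D).

Lemma survival_lipschitz v w : v <= w -> S v <= S w + (w - v).
Proof.
move=> vw; rewrite -lee_fin EFinD !(survivalE mD).
apply: (@le_trans _ _ (mu ([set t | I t /\ w <= D t] `|`
    [set t | I t /\ (v <= D t <= w)%R]))).
  apply: le_measure; rewrite ?inE//.
  - exact: measurable_le_D.
  - by apply: measurableU; [exact: measurable_le_D|exact: measurable_D_itv].
  move=> t [It h]; have [?|/ltW ?] := leP w (D t); [left|right] => //.
  by split => //; rewrite h.
apply: le_trans (measureU2 _ _ _) _.
- exact: measurable_le_D.
- exact: measurable_D_itv.
by rewrite leeD2l// D_density.
Qed.

Lemma survival_continuous : continuous S.
Proof.
move=> v; apply/cvgrPdist_le => /= e e0; near=> w.
have vw : `|v - w| <= e by near: w; exact: cvgr_dist_le.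
move: vw; rewrite !ler_norml => /andP[h1 h2].
have [vw|/ltW vw] := leP v w.
- have := survival_lipschitz vw; have := survival_nonincreasing mD vw.
  by move=> *; apply/andP; split; lra.
- have := survival_lipschitz vw; have := survival_nonincreasing mD vw.
  by move=> *; apply/andP; split; lra.
Unshelve. all: by end_near. Qed.

Definition excess (a : R) : set (measurableTypeR R * measurableTypeR R) :=
  [set z | [/\ I z.1, I z.2 & D z.1 + a <= D z.2]].

Lemma measurable_excess a : measurable (excess a).
Proof.
have -> : excess a = (I `*` I) `&`
    [set z : measurableTypeR R * measurableTypeR R | (D z.1 + a <= D z.2)%R].
  by apply/seteqP; split => z /= => [[]|[[]]].
apply: measurableI; first exact: measurableX.
apply: measurable_ler_set; last exact: measurableT_comp.
by apply: measurable_funD => //; exact: measurableT_comp.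
Qed.

Lemma xsection_excess a s :
  mu (xsection (excess a) s) = ((fun s => (S (D s + a))%:E) \_ I) s.
Proof.
rewrite patchE; case: ifPn => [|/negP]; rewrite inE => sI.
  rewrite (survivalE mD); congr (mu _); apply/seteqP.
  by split => t; rewrite /xsection/= inE/=; case.
rewrite (_ : xsection _ _ = set0) ?measure0//; apply/seteqP; split => u //.
by rewrite /xsection/= inE/= => -[].
Qed.

Lemma measure_excess a :
  (mu \x mu)%E (excess a) = (\int[mu]_(s in I) (S (D s + a))%:E)%E.
Proof.
rewrite [RHS]integral_mkcond.
by apply: eq_integral => s _; exact: xsection_excess.
Qed.

Lemma measure_excess_swap a :
  (mu \x mu)%E [set z | [/\ I z.1, I z.2 & D z.2 + a <= D z.1]] =
  (mu \x mu)%E (excess a).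
Proof.
rewrite [LHS]/product_measure1/= fubini_section; last first.
  have := @measurable_swap _ _ (measurableTypeR R) (measurableTypeR R)
    measurableT _ (measurable_excess a).
  by rewrite setTI; congr measurable; apply/seteqP; split => z /= [].
apply: eq_integral => y _ /=; congr (mu _); apply/seteqP.
by split => t; rewrite /xsection/ysection/= !inE/= => -[].
Qed.

(** Surjectivity onto [0,1] is what makes [survival D (D s)] uniformly
    distributed; it is where atoms of the law of D are excluded. *)
Lemma survival_quantile (M u : R) : (forall t, I t -> - M <= D t <= M) ->
  0 <= u <= 1 -> exists v, S v = u.
Proof.
move=> DM u01.
have S1 : S (- M) = 1.
  apply/eqP; rewrite eq_le (survival_le1 mD)/= -lee_fin (survivalE mD) -lebesgue_unit_itv.
  apply: le_measure; rewrite ?inE//; first exact: measurable_le_D.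
  by move=> t It; split => //; have /andP[] := DM t It.
have M0 : 0 <= M.
  have /DM/andP[h1 h2] : I 0 by rewrite /= in_itv/= lexx ler01.
  by lra.
have S0 : S (M + 1) = 0.
  rewrite /S (_ : mkset _ = set0) ?measure0//.
  apply/seteqP; split => t //= -[It h]; have /andP[_ h2] := DM t It; lra.
have [|||v _ <-] := @IVT R S (- M) (M + 1) u; last by exists v.
- by lra.
- by apply: continuous_subspaceT; exact: survival_continuous.
- by rewrite S0 S1 min_r ?max_l.
Qed.

(** The substitution s -> S(D s) replaces D by a uniform variable without
    increasing differences, S being 1-Lipschitz. *)
Lemma measure_excess_ge (M a : R) : (forall t, I t -> - M <= D t <= M) ->
  0 < a <= 1 -> (((1 - a) ^+ 2 / 2)%:E <= (mu \x mu)%E (excess a))%E.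
Proof.
move=> DM /andP[a0 a1]; rewrite measure_excess -integral_onem//.
apply: (@le_trans _ _ (\int[mu]_(s in I) (Num.max 0 (S (D s) - a))%:E)%E).
  rewrite integral_excess; last 2 first.
  - exact: (measurableT_comp (measurable_survival mD)).
  - by move=> s _; exact: (survival_le1 mD).
  apply: ge0_le_integral => //.
  - by move=> u /=; rewrite in_itv/= => /andP[_ u1]; rewrite lee_fin subr_ge0.
  - by apply/measurable_EFinP; apply: measurable_funB.
  - apply: (measurable_measure_le (measurableT_comp (measurable_survival mD) mD)).
  - move=> u /=; rewrite in_itv/= => /andP[au u1].
    (* If S(v) = u then D(s) <= v implies S(D s) >= u, and D <= v fails only
       on a set of measure at most S(v) = u. *)
    have /(survival_quantile DM)[v vu] : 0 <= u <= 1.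
      by rewrite u1 andbT (le_trans (ltW a0)).
    rewrite EFinB leeBlDr// -[X in (_ <= _ + X%:E)%E]vu (survivalE mD) -lebesgue_unit_itv.
    apply: (@le_trans _ _ (mu ([set s | I s /\ D s <= v] `|`
        [set s | I s /\ v <= D s]))).
      apply: le_measure; rewrite ?inE//.
        by apply: measurableU; [exact: measurable_D_le|exact: measurable_le_D].
      by move=> t It; have [?|/ltW ?] := leP (D t) v; [left|right].
    apply: le_trans (measureU2 _ _ _) _.
    - exact: measurable_D_le.
    - exact: measurable_le_D.
    rewrite leeD2r//; apply: le_measure; rewrite ?inE.
    - exact: measurable_D_le.
    - exact: (measurable_le_D (measurableT_comp (measurable_survival mD) mD)).
    - move=> t [It Dtv]; split => //; rewrite -vu; exact: survival_nonincreasing.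
apply: ge0_le_integral => //.
- by move=> s _; rewrite lee_fin le_max lexx.
- apply/measurable_EFinP; apply: measurable_maxr => //; apply: measurable_funB => //.
  by apply: measurable_funTS; exact: (measurableT_comp (measurable_survival mD)).
- apply/measurable_EFinP; apply: measurable_funTS.
  by apply: (measurableT_comp (measurable_survival mD)); exact: measurable_funD.
- move=> s _; rewrite lee_fin ge_max (survival_ge0 mD)/= lerBlDr.
  have := @survival_lipschitz (D s) (D s + a); rewrite lerDl ltW//.
  by rewrite addrAC subrr add0r; apply.
Qed.

(** Here S(v) <= 1/2 - v, because D is at most 1/2 and has density at most 1;
    and u <= 1/2 - D(s) confines D(s) to an interval of length 1 - u. *)
Lemma measure_excess_le (a : R) : (forall t, I t -> - 2^-1 <= D t <= 2^-1) ->
  0 < a <= 1 -> ((mu \x mu)%E (excess a) <= ((1 - a) ^+ 2 / 2)%:E)%E.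
Proof.
move=> Dhalf /andP[a0 a1]; rewrite measure_excess -integral_onem//.
apply: (@le_trans _ _ (\int[mu]_(s in I) (Num.max 0 ((2^-1 - D s) - a))%:E)%E).
  apply: ge0_le_integral => //.
  - by move=> s _; rewrite lee_fin (survival_ge0 mD).
  - apply/measurable_EFinP; apply: measurable_funTS.
    by apply: (measurableT_comp (measurable_survival mD)); exact: measurable_funD.
  - apply/measurable_EFinP; apply: measurable_maxr => //; apply: measurable_funB => //.
    by apply: measurable_funTS; apply: measurable_funB.
  - move=> s Is; rewrite (survivalE mD).
    have [h|h] := leP (D s + a) 2^-1.
      apply: (@le_trans _ _ (mu [set t | I t /\ D s + a <= D t <= 2^-1])).
        apply: le_measure; rewrite ?inE//.
        + exact: measurable_le_D.
        + exact: measurable_D_itv.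
        + by move=> t [It ht]; split => //; rewrite ht; have /andP[] := Dhalf t It.
      by apply: le_trans (D_density h) _; rewrite lee_fin le_max; apply/orP; right; lra.
    rewrite (_ : mkset _ = set0) ?measure0 ?lee_fin ?le_max ?lexx//.
    apply/seteqP; split => t //= -[It ht]; have /andP[_ h2] := Dhalf t It; lra.
rewrite integral_excess; last 2 first.
- exact: measurable_funB.
- by move=> s Is; have /andP[h _] := Dhalf s Is; lra.
apply: ge0_le_integral => //.
- by apply: measurable_measure_le; exact: measurable_funB.
- by apply/measurable_EFinP; apply: measurable_funB.
- move=> u /=; rewrite in_itv/= => /andP[au u1].
  apply: (@le_trans _ _ (mu [set t | I t /\ - 2^-1 <= D t <= 2^-1 - u])).
    apply: le_measure; rewrite ?inE.
    + by apply: measurable_le_D; exact: measurable_funB.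
    + exact: measurable_D_itv.
    + move=> t [It ht]; split => //; have /andP[-> _] := Dhalf t It; lra.
  by apply: le_trans (D_density _) _; [lra|rewrite lee_fin; lra].
Qed.

End two_points.

Section two_point_distribution.
Context {R : realType}.
Notation mu := (@lebesgue_measure R).
Notation I := (`[0%R, 1%R]%classic : set R).
Variable D : R -> R.
Hypothesis mD : measurable_fun setT D.
Hypothesis D_density : forall a b, a <= b ->
  (mu [set t | I t /\ (a <= D t <= b)%R] <= (b - a)%:E)%E.

Lemma measure_two_point a : 0 < a ->
  (mu \x mu)%E [set z | (I `*` I) z /\ (a <= `|D z.2 - D z.1|)%R] =
  ((mu \x mu) (excess D a) + (mu \x mu) (excess D a))%E.
Proof.
move=> a0; rewrite -[in X in (_ + X)%E]measure_excess_swap//.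
(* For a > 0 the events D(y) >= D(x) + a and D(x) >= D(y) + a are disjoint. *)
rewrite -measureU//; last 3 first.
- exact: measurable_excess.
- have := @measurable_swap _ _ (measurableTypeR R) (measurableTypeR R)
    measurableT _ (measurable_excess mD a).
  by rewrite setTI; congr measurable; apply/seteqP; split => z /= [].
- by apply/seteqP; split => z //= [[_ _ h1] [_ _ h2]]; lra.
congr ((mu \x mu)%E _); apply/seteqP; split => z /=.
  move=> [[z1 z2]]; rewrite ler_normr opprB => /orP[h|h]; [left|right];
    by split => //; lra.
by move=> [[z1 z2 h]|[z1 z2 h]]; split => //; rewrite ler_normr opprB;
  apply/orP; [left|right]; lra.
Qed.

Lemma measure_two_point_ge (M a : R) : (forall t, I t -> - M <= D t <= M) ->
  0 < a -> ((Num.max 0 (1 - 1 * a) ^+ 2)%:E <=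
  (mu \x mu) [set z | (I `*` I) z /\ (a <= `|D z.2 - D z.1|)%R])%E.
Proof.
move=> DM a0; rewrite mul1r; have [a1|a1] := leP a 1; last first.
  by rewrite max_l ?subr_le0 ?(ltW a1)// expr0n/= measure_ge0.
rewrite measure_two_point// max_r ?subr_ge0//.
rewrite [((1 - a) ^+ 2)](_ : _ = (1 - a) ^+ 2 / 2 + (1 - a) ^+ 2 / 2); last by field.
by rewrite EFinD leeD// (measure_excess_ge mD D_density DM)// a0.
Qed.

Lemma measure_two_point_eq (a : R) : (forall t, I t -> - 2^-1 <= D t <= 2^-1) ->
  0 < a ->
  ((mu \x mu) [set z | (I `*` I) z /\ (a <= `|D z.2 - D z.1|)%R])%E =
  (Num.max 0 (1 - 1 * a) ^+ 2)%:E.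
Proof.
move=> Dhalf a0; apply/eqP; rewrite eq_le (measure_two_point_ge Dhalf)// andbT.
rewrite mul1r; have [a1|a1] := leP a 1; last first.
  rewrite (_ : mkset _ = set0) ?measure0 ?lee_fin ?sqr_ge0//.
  apply/seteqP; split => z //= -[[/Dhalf/andP[? ?] /Dhalf/andP[? ?]]].
  by rewrite ler_normr => /orP[?|?]; lra.
rewrite measure_two_point// max_r ?subr_ge0//.
rewrite [((1 - a) ^+ 2)](_ : _ = (1 - a) ^+ 2 / 2 + (1 - a) ^+ 2 / 2); last by field.
by rewrite EFinD leeD// (measure_excess_le mD D_density Dhalf)// a0.
Qed.

End two_point_distribution.

(** * The minimal Lorentz norms *)

Section minimal_norms.
Context {R : realType}.
Notation mu := (@lebesgue_measure R).

Lemma disc_bounded (P : {fset R}) (t : R) : 0 <= t <= 1 ->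
  - #|` P|%:R <= disc P t <= #|` P|%:R.
Proof.
move=> /andP[t0 t1]; rewrite /disc.
have h0 : 0 <= \sum_(x <- P) \1_(`[0, t[ : set R) x :> R by exact: sumr_ge0.
have h1 : \sum_(x <- P) \1_(`[0, t[ : set R) x <= #|` P|%:R :> R.
  rewrite -[leRHS](_ : \sum_(x <- P) 1 = #|` P|%:R); last first.
    by rewrite big_const_seq/= count_predT iter_addr_0.
  by apply: ler_sum => x _; rewrite indicE lern1 leq_b1.
have h2 : 0 <= #|` P|%:R * t by rewrite mulr_ge0.
have h3 : #|` P|%:R * t <= #|` P|%:R by rewrite ler_piMr.
by apply/andP; split; lra.
Qed.

Lemma ereal_inf_attained (T : Type) (A : set T) (f : T -> \bar R) (x : T) v :
  A x -> f x = v -> (forall y, A y -> (v <= f y)%E) ->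
  ereal_inf [set f y | y in A] = v.
Proof.
move=> Ax fx vmin; apply/eqP; rewrite eq_le; apply/andP; split.
  by apply: ereal_inf_lbound; exists x.
by apply: le_ereal_inf_tmp => _ [y Ay <-]; exact: vmin.
Qed.

End minimal_norms.

Theorem corollary4p4 (R : realType) (p q : R) (N : nat)
    (hp : 0 < p) (hq : 0 < q) (hN : (0 < N)%N) :
  ereal_inf [set (disc_norm p q P `^ q)%E | P in unit_points N] =
    (p / 2 `^ q * Beta q (1 + q / p))%:E /\
  ereal_inf [set (disc2_norm p q P `^ q)%E | P in unit_points N] =
    (p * Beta q (1 + 2 * q / p))%:E.
Proof.
have Mu : unit_points N (midpoints N : {fset R}) by exact: midpoints_unit.
have [cardM _] := Mu.
have half (t : R) : `[0%R, 1%R]%classic t -> - 2^-1 <= disc (midpoints N) t <= 2^-1.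
  by move=> /=; rewrite in_itv; exact: disc_midpoints.
have dens (P : {fset R}) : #|` P| = N -> forall a b : R, a <= b ->
    (lebesgue_measure [set t | `[0%R, 1%R]%classic t /\ (a <= disc P t <= b)%R]
     <= (b - a)%:E)%E.
  by move=> cP a b; apply: disc_density_le1; rewrite cP.
split.
- apply: (ereal_inf_attained Mu).
    rewrite /disc_norm (@lorentz_norm_tent _ _ _ _ _ p q hp hq _ 2 1)//.
      by congr EFin; rewrite mulrA mul1r.
    by move=> a a0; apply: measure_le_absD_eq => //; [exact: measurable_disc|exact: dens].
  move=> P [cP _].
  have -> : p / 2 `^ q * Beta q (1 + q / p) =
      p * ((2 `^ q)^-1 * Beta q (1 + 1%:R * q / p)) by rewrite mulrA mul1r.
  apply: lorentz_norm_ge_tent => //.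
  - by rewrite /= lebesgue_unit_itv ltry.
  - by apply: measurable_funTS; exact: measurable_disc.
  - move=> a a0; apply: measure_le_absD_ge => //; [exact: measurable_disc|exact: dens].
- have mu2 : ((lebesgue_measure \x lebesgue_measure)
      (`[0%R, 1%R]%classic `*` `[0%R, 1%R]%classic : set (measurableTypeR R * measurableTypeR R)) < +oo)%E.
    by rewrite product_measure1E//= !lebesgue_unit_itv mul1e ltry.
  apply: (ereal_inf_attained Mu).
    rewrite /disc2_norm (@lorentz_norm_tent _ _ _ _ _ p q hp hq _ 1 2)//.
      by congr EFin; rewrite powR1 invr1 mul1r.
    move=> a a0; apply: measure_two_point_eq => //; [exact: measurable_disc|exact: dens].
  move=> P [cP _].
  have -> : p * Beta q (1 + 2 * q / p) =
      p * ((1 `^ q)^-1 * Beta q (1 + 2%:R * q / p)) by rewrite powR1 invr1 mul1r.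
  apply: lorentz_norm_ge_tent => //.
  - exact: measurableX.
  - apply: measurable_funTS; apply: measurable_funB; apply: measurableT_comp => //; exact: measurable_disc.
  - move=> a a0; apply: (@measure_two_point_ge _ _ _ _ #|` P|%:R) => //.
    + exact: measurable_disc.
    + exact: dens.
    + by move=> t /=; rewrite in_itv; exact: disc_bounded.
Qed.
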